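(* Let $(\mathcal{A},\varphi,\mathcal{X},f,\Phi)$ be a non-commutative probability space of type B, let $\mathfrak{E}=\mathcal{X}\oplus\mathcal{A}$, and equip $\mathcal{A}\times\mathfrak{E}$ with the $\mathcal{C}$-bimodule structure $$(x,t)(a,\xi+b)=(a,\xi+b)(x,t)=(ax,\ at+(\xi+b)x),\qquad (x,t)\in\mathcal{C},\ a,b\in\mathcal{A},\ \xi\in\mathcal{X},$$ where $at$ denotes the element $ta\in\mathcal{A}\subset\mathfrak{E}$. Then the map $$\widetilde{E}:\mathcal{A}\times\mathfrak{E}\to\mathcal{C},\qquad \widetilde{E}(a,\xi+b)=\big(\varphi(a),\,f(\xi)+\varphi(b)\big),$$ which extends the map $E:\mathcal{A}\times\mathcal{X}\to\mathcal{C}$, $E(a,\xi)=(\varphi(a),f(\xi))$, is a conditional expectation onto $\mathcal{C}$ (where $\mathcal{C}$ is viewed inside $\mathcal{A}\times\mathfrak{E}$ via $(x,t)\mapsto(x1,t1)$); in particular $$\widetilde{E}\big((x,t)(a,\xi+b)\big)=(x,t)\,\widetilde{E}(a,\xi+b)$$ for all $(x,t)\in\mathcal{C}$, $a,b\in\mathcal{A}$, $\xi\in\mathcal{X}$.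
   Context: A non-commutative probability space of type B is a system $(\mathcal{A},\varphi,\mathcal{X},f,\Phi)$ where $\mathcal{A}$ is a complex unital algebra, $\varphi:\mathcal{A}\to\mathbb{C}$ is linear with $\varphi(1)=1$, $\mathcal{X}$ is a complex vector space, $f:\mathcal{X}\to\mathbb{C}$ is linear, and $\Phi:\mathcal{A}\times\mathcal{X}\times\mathcal{A}\to\mathcal{X}$ is a two-sided action of $\mathcal{A}$ on $\mathcal{X}$ (an $\mathcal{A}$-bimodule structure), written $a\xi b=\Phi(a,\xi,b)$. $\mathcal{C}$ is the commutative unital algebra $\mathbb{C}\times\mathbb{C}$ (with componentwise vector space structure) with multiplication $(x,t)\cdot(y,s)=(xy,xs+ty)$ and unit $(1,0)$. The two-sided action of $\mathcal{A}$ on $\mathfrak{E}=\mathcal{X}\oplus\mathcal{A}$ is the direct sum of the action $\Phi$ and the multiplication of $\mathcal{A}$; $\mathcal{A}\times\mathfrak{E}$ is a unital algebra with multiplication $(a,u)(b,v)=(ab,\,av+ub)$ for $a,b\in\mathcal{A}$, $u,v\in\mathfrak{E}$. A conditional expectation onto $\mathcal{C}$ means a linear $\mathcal{C}$-bimodule map $\mathcal{A}\times\mathfrak{E}\to\mathcal{C}$ which restricts to the identity on $\mathcal{C}$. *)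

(* Defs.v *)
From HB Require Import structures.
From mathcomp Require Import all_boot all_order all_algebra.
From mathcomp Require Import complex.
From mathcomp Require Import reals.

Set Implicit Arguments.
Unset Strict Implicit.
Unset Printing Implicit Defensive.

Import GRing.Theory.
Local Open Scope ring_scope.

Record bimodule (K : comNzRingType) (B : algType K) (M : lmodType K) :=
  Bimodule {
    act2 :> B -> M -> B -> M;
    act2_linearl : forall u c, linear (fun b => act2 b u c);
    act2_linearm : forall b c, linear (fun u => act2 b u c);
    act2_linearr : forall b u, linear (fun c => act2 b u c);
    act2_1 : forall u, act2 1 u 1 = u;
    act2A : forall a b u c d, act2 a (act2 b u c) d = act2 (a * b) u (c * d)
  }.

Section OneSided.
Variables (K : comNzRingType) (B : algType K) (M : lmodType K).
Variable Psi : bimodule B M.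

Definition lact (b : B) (u : M) : M := Psi b u 1.
Definition ract (u : M) (b : B) : M := Psi 1 u b.

Lemma lactDr b u v : lact b (u + v) = lact b u + lact b v.
Proof. by have := act2_linearm Psi b 1 1 u v; rewrite !scale1r. Qed.

Lemma lactDl b c u : lact (b + c) u = lact b u + lact c u.
Proof. by have := act2_linearl Psi u 1 1 b c; rewrite !scale1r. Qed.

Lemma ractDl u v b : ract (u + v) b = ract u b + ract v b.
Proof. by have := act2_linearm Psi 1 b 1 u v; rewrite !scale1r. Qed.

Lemma ractDr u b c : ract u (b + c) = ract u b + ract u c.
Proof. by have := act2_linearr Psi 1 u 1 b c; rewrite !scale1r. Qed.

Lemma lact0r b : lact b 0 = 0.
Proof. by apply: (addrI (lact b 0)); rewrite -lactDr !addr0. Qed.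

Lemma lact0l u : lact 0 u = 0.
Proof. by apply: (addrI (lact 0 u)); rewrite -lactDl !addr0. Qed.

Lemma ract0l b : ract 0 b = 0.
Proof. by apply: (addrI (ract 0 b)); rewrite -ractDl !addr0. Qed.

Lemma ract0r u : ract u 0 = 0.
Proof. by apply: (addrI (ract u 0)); rewrite -ractDr !addr0. Qed.

Lemma lactZl k b u : lact (k *: b) u = k *: lact b u.
Proof.
by have := act2_linearl Psi u 1 k b 0; rewrite !addr0 /lact => ->;
   rewrite [X in _ + X]lact0l addr0.
Qed.

Lemma lactZr k b u : lact b (k *: u) = k *: lact b u.
Proof.
by have := act2_linearm Psi b 1 k u 0; rewrite !addr0 /lact => ->;
   rewrite [X in _ + X]lact0r addr0.
Qed.

Lemma ractZl k u b : ract (k *: u) b = k *: ract u b.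
Proof.
by have := act2_linearm Psi 1 b k u 0; rewrite !addr0 /ract => ->;
   rewrite [X in _ + X]ract0l addr0.
Qed.

Lemma ractZr k u b : ract u (k *: b) = k *: ract u b.
Proof.
by have := act2_linearr Psi 1 u k b 0; rewrite !addr0 /ract => ->;
   rewrite [X in _ + X]ract0r addr0.
Qed.

Lemma lactM a b u : lact (a * b) u = lact a (lact b u).
Proof. by rewrite /lact act2A mulr1. Qed.

Lemma ractM u a b : ract u (a * b) = ract (ract u a) b.
Proof. by rewrite /ract act2A mulr1. Qed.

Lemma lract a u b : lact a (ract u b) = ract (lact a u) b.
Proof. by rewrite /lact /ract !act2A !mulr1 !mul1r. Qed.

End OneSided.

Section SquareZero.
Variables (K : comNzRingType) (B : algType K) (M : lmodType K).

(* B x M with the product (a, u) (b, v) = (ab, av + ub). *)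
Definition sqzero (Psi : bimodule B M) : Type := (B * M)%type.

Variable Psi : bimodule B M.
Notation T := (sqzero Psi).

HB.instance Definition _ := GRing.Lmodule.copy T (B * M)%type.

Definition sqzero_one : T := (1, 0).
Definition sqzero_mul (p q : T) : T :=
  (p.1 * q.1, lact Psi p.1 q.2 + ract Psi p.2 q.1).

Fact sqzero_mulA : associative sqzero_mul.
Proof.
move=> [a u] [b v] [c w]; rewrite /sqzero_mul /=; congr pair.
  by rewrite mulrA.
by rewrite lactM ractM lactDr ractDl lract addrA.
Qed.

Fact sqzero_mul1l : left_id sqzero_one sqzero_mul.
Proof.
by move=> [a u]; rewrite /sqzero_mul /= mul1r ract0l addr0 /lact act2_1.
Qed.

Fact sqzero_mul1r : right_id sqzero_one sqzero_mul.
Proof.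
by move=> [a u]; rewrite /sqzero_mul /= mulr1 lact0r add0r /ract act2_1.
Qed.

Fact sqzero_mulDl : left_distributive sqzero_mul +%R.
Proof.
move=> [a u] [b v] [c w]; rewrite /sqzero_mul /=; congr pair => /=.
  by rewrite mulrDl.
by rewrite lactDl ractDl addrACA.
Qed.

Fact sqzero_mulDr : right_distributive sqzero_mul +%R.
Proof.
move=> [a u] [b v] [c w]; rewrite /sqzero_mul /=; congr pair => /=.
  by rewrite mulrDr.
by rewrite lactDr ractDr addrACA.
Qed.

Fact sqzero_one_neq0 : sqzero_one != 0 :> T.
Proof. by apply/eqP => -[] /eqP; rewrite oner_eq0. Qed.

HB.instance Definition _ := GRing.Zmodule_isNzRing.Build T
  sqzero_mulA sqzero_mul1l sqzero_mul1r sqzero_mulDl sqzero_mulDr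
  sqzero_one_neq0.

Fact sqzero_scalerAl (k : K) (p q : T) : k *: (p * q) = (k *: p) * q.
Proof.
case: p q => [a u] [b v]; congr pair => /=; first by rewrite scalerAl.
by rewrite scalerDr lactZl ractZl.
Qed.

HB.instance Definition _ := GRing.Lmodule_isLalgebra.Build K T sqzero_scalerAl.

Fact sqzero_scalerAr (k : K) (p q : T) : k *: (p * q) = p * (k *: q).
Proof.
case: p q => [a u] [b v]; congr pair => /=; first by rewrite scalerAr.
by rewrite scalerDr lactZr ractZr.
Qed.

HB.instance Definition _ :=
  GRing.Lalgebra_isAlgebra.Build K T sqzero_scalerAr.

End SquareZero.

Section DualNumbers.
Variable K : comNzRingType.

(* A type distinct from K^o * K^o, whose default product is componentwise. *)
Definition dualnum : Type := (K^o * K^o)%type.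

HB.instance Definition _ := GRing.Lmodule.copy dualnum (K^o * K^o)%type.

Definition dualnum_one : dualnum := (1, 0).
Definition dualnum_mul (c d : dualnum) : dualnum :=
  (c.1 * d.1, c.1 * d.2 + c.2 * d.1).

Fact dualnum_mulA : associative dualnum_mul.
Proof.
move=> [x t] [y s] [z r]; rewrite /dualnum_mul /=; congr pair.
  by rewrite mulrA.
by rewrite mulrDr mulrDl !mulrA addrA.
Qed.

Fact dualnum_mulC : commutative dualnum_mul.
Proof.
move=> [x t] [y s]; rewrite /dualnum_mul /=; congr pair; first exact: mulrC.
by rewrite addrC (mulrC (t : K)) (mulrC (x : K)).
Qed.

Fact dualnum_mul1l : left_id dualnum_one dualnum_mul.
Proof. by move=> [x t]; rewrite /dualnum_mul /= !mul1r mul0r addr0. Qed.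

Fact dualnum_mulDl : left_distributive dualnum_mul +%R.
Proof.
move=> [x t] [y s] [z r]; rewrite /dualnum_mul /=; congr pair => /=.
  by rewrite mulrDl.
by rewrite !mulrDl addrACA.
Qed.

Fact dualnum_one_neq0 : dualnum_one != 0 :> dualnum.
Proof. by apply/eqP => -[] /eqP; rewrite oner_eq0. Qed.

HB.instance Definition _ := GRing.Zmodule_isComNzRing.Build dualnum
  dualnum_mulA dualnum_mulC dualnum_mul1l dualnum_mulDl dualnum_one_neq0.

Fact dualnum_scalerAl (k : K) (c d : dualnum) :
  k *: (c * d : dualnum) = (k *: c : dualnum) * d.
Proof.
case: c d => [x t] [y s]; apply/pair_equal_spec; split=> /=.
  exact: mulrA.
by rewrite /GRing.scale /= mulrDr !mulrA.
Qed.

HB.instance Definition _ :=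
  GRing.Lmodule_isLalgebra.Build K dualnum dualnum_scalerAl.

Fact dualnum_scalerAr (k : K) (c d : dualnum) :
  k *: (c * d : dualnum) = c * (k *: d : dualnum).
Proof. by rewrite [in RHS]mulrC -scalerAl mulrC. Qed.

HB.instance Definition _ :=
  GRing.Lalgebra_isAlgebra.Build K dualnum dualnum_scalerAr.

End DualNumbers.

Section DirectSum.
Variables (K : comNzRingType) (A : algType K) (X : lmodType K).
Variable Phi : bimodule A X.

(* The element xi + b of the direct sum of X and A is the pair (xi, b). *)
Definition dsum_act (a : A) (u : X * A) (c : A) : X * A :=
  (Phi a u.1 c, a * u.2 * c).

Fact dsum_act_linearl u c : linear (fun a => dsum_act a u c).
Proof.
move=> k a b; congr pair => /=; first exact: act2_linearl.
by rewrite !mulrDl -!scalerAl.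
Qed.

Fact dsum_act_linearm a c : linear (fun u => dsum_act a u c).
Proof.
move=> k u v; congr pair => /=; first exact: act2_linearm.
by rewrite mulrDr mulrDl -scalerAr -scalerAl.
Qed.

Fact dsum_act_linearr a u : linear (fun c => dsum_act a u c).
Proof.
move=> k b c; congr pair => /=; first exact: act2_linearr.
by rewrite mulrDr -scalerAr.
Qed.

Fact dsum_act_1 u : dsum_act 1 u 1 = u.
Proof. by case: u => xi b; rewrite /dsum_act act2_1 mulr1 mul1r. Qed.

Fact dsum_actA a b u c d :
  dsum_act a (dsum_act b u c) d = dsum_act (a * b) u (c * d).
Proof. by rewrite /dsum_act act2A /= !mulrA. Qed.

Definition dsum_bimodule : bimodule A (X * A)%type :=
  Bimodule dsum_act_linearl dsum_act_linearm dsum_act_linearr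
           dsum_act_1 dsum_actA.

End DirectSum.

(* A is automatically nontrivial in a probability space, since phi 1 = 1, so
   nothing is lost by algType excluding the zero algebra. *)
Record ncpsB (R : realType) := NCPSB {
  algA : algType R[i];
  phi : {scalar algA};
  phi1 : phi 1 = 1;
  modX : lmodType R[i];
  funf : {scalar modX};
  actPhi : bimodule algA modX
}.

Section TypeB.
Variables (R : realType) (S : ncpsB R).
Local Notation A := (algA S).
Local Notation X := (modX S).

Definition CC : Type := dualnum R[i].
HB.instance Definition _ := GRing.ComNzRing.on CC.
HB.instance Definition _ := GRing.Algebra.on CC.

Definition AX : Type := sqzero (actPhi S).
HB.instance Definition _ := GRing.Algebra.on AX.

Definition AE : Type := sqzero (dsum_bimodule (actPhi S)).
HB.instance Definition _ := GRing.Algebra.on AE.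

Definition E (w : AX) : CC := (phi S w.1, funf S w.2).

Definition AX_to_AE (w : AX) : AE := (w.1, (w.2, 0)).

Definition Etilde (w : AE) : CC :=
  (phi S w.1, funf S w.2.1 + phi S w.2.2).

Definition CC_to_AE (c : CC) : AE := (c.1 *: 1, (0, c.2 *: 1)).

Fact CC_to_AE_linear : linear CC_to_AE.
Proof.
move=> k [x t] [y s]; congr (_, (_, _)) => /=.
- by rewrite scalerDl scalerA.
- by rewrite scaler0 addr0.
- by rewrite scalerDl scalerA.
Qed.

Fact CC_to_AE_monoid_morphism : monoid_morphism CC_to_AE.
Proof.
split=> [|[x t] [y s]].
  by rewrite /CC_to_AE /= scale1r scale0r.
congr (_, (_, _)) => /=.
- by rewrite -scalerAl mul1r scalerA.
- by rewrite [X in X + _]lact0r [X in _ + X]ract0l addr0.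
- by rewrite !mulr1 mul1r -!scalerAl !mul1r !scalerA scalerDl.
Qed.

HB.instance Definition _ :=
  GRing.isLinear.Build R[i] CC AE _ CC_to_AE CC_to_AE_linear.
HB.instance Definition _ :=
  GRing.isMonoidMorphism.Build CC AE CC_to_AE CC_to_AE_monoid_morphism.

(* (x, t) (a, xi + b) = (a x, a t + (xi + b) x), where a t lies in the summand
   A of the direct sum. The same formula gives the right action. *)
Definition CC_mul (c : CC) (w : AE) : AE :=
  (c.1 *: w.1, (0, c.2 *: w.1) + c.1 *: w.2).

Fact CC_mulE c w : CC_mul c w = CC_to_AE c * w.
Proof.
case: c w => [x t] [a [xi b]]; congr (_, (_, _)) => /=.
- by rewrite -scalerAl mul1r.
- have := lactZl (actPhi S) x 1 xi; have := ract0l (actPhi S) a.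
  by rewrite /lact /ract act2_1 => -> ->; rewrite add0r addr0.
- by rewrite !mulr1 mul1r -!scalerAl !mul1r addrC.
Qed.

Fact CC_mulEr c w : CC_mul c w = w * CC_to_AE c.
Proof.
case: c w => [x t] [a [xi b]]; congr (_, (_, _)) => /=.
- by rewrite -scalerAr mulr1.
- have := ractZr (actPhi S) x xi 1; have := lact0r (actPhi S) a.
  by rewrite /lact /ract act2_1 => -> ->; rewrite add0r.
- by rewrite !mulr1 mul1r -!scalerAr !mulr1.
Qed.

Definition CC_act (c : CC) (w : AE) (d : CC) : AE := CC_mul c (CC_mul d w).

Fact CC_actE c w d : CC_act c w d = CC_to_AE c * w * CC_to_AE d.
Proof. by rewrite /CC_act CC_mulE CC_mulEr mulrA. Qed.

Fact CC_act_linearl w d : linear (fun c => CC_act c w d).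
Proof. by move=> k c c'; rewrite !CC_actE linearP !mulrDl -!scalerAl. Qed.

Fact CC_act_linearm c d : linear (fun w => CC_act c w d).
Proof. by move=> k w w'; rewrite !CC_actE mulrDr mulrDl -scalerAr -scalerAl. Qed.

Fact CC_act_linearr c w : linear (fun d => CC_act c w d).
Proof. by move=> k d d'; rewrite !CC_actE linearP mulrDr -scalerAr. Qed.

Fact CC_act_1 w : CC_act 1 w 1 = w.
Proof. by rewrite CC_actE rmorph1 mulr1 mul1r. Qed.

Fact CC_actA a b w c d :
  CC_act a (CC_act b w c) d = CC_act (a * b) w (c * d).
Proof. by rewrite !CC_actE !rmorphM !mulrA. Qed.

Definition CC_bimodule : bimodule CC AE :=
  Bimodule CC_act_linearl CC_act_linearm CC_act_linearr CC_act_1 CC_actA.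

Lemma CC_lactE (c : CC) (w : AE) :
  lact CC_bimodule c w = (c.1 *: w.1, (0, c.2 *: w.1) + c.1 *: w.2).
Proof. by rewrite /lact /= CC_actE rmorph1 mulr1 -CC_mulE. Qed.

Lemma CC_ractE (w : AE) (c : CC) :
  ract CC_bimodule w c = (c.1 *: w.1, (0, c.2 *: w.1) + c.1 *: w.2).
Proof. by rewrite /ract /= CC_actE rmorph1 mul1r -CC_mulEr. Qed.

End TypeB.

Arguments E {R} S w.
Arguments AX_to_AE {R} S w.
Arguments Etilde {R} S w.
Arguments CC_to_AE {R} S c.
Arguments CC_bimodule {R} S.

(* B is viewed inside D through the unital algebra morphism iota. *)
Record conditional_expectation (K : comNzRingType) (B D : algType K)
    (iota : {lrmorphism B -> D}) (Psi : bimodule B D) (F : D -> B) : Prop :=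
  ConditionalExpectation {
    ce_linear : linear F;
    ce_bimodule : forall b w c, F (Psi b w c) = b * F w * c;
    ce_id : forall b, F (iota b) = b
  }.

(* Main.v *)
Require Import Defs.
From HB Require Import structures.
From mathcomp Require Import all_boot all_order all_algebra.
From mathcomp Require Import complex.
From mathcomp Require Import reals.

Import GRing.Theory.
Local Open Scope ring_scope.

(** The dual number (x, t) is x + t e with e ^ 2 = 0, and it acts on
    (a, xi + b) by scaling everything by x and adding t a to the summand A of
    the second component.  Both [phi] and [funf] are linear, so [Etilde] carries
    scaling by x to scaling by x; and since [Etilde] reads that summand through
    [phi], the added t a contributes t (phi a), which is the e-part of the
    product of (x, t) with [Etilde] (a, xi + b).  This is [Etilde_CC_mul].
    The left and right actions are the same map and dual numbers commute, so
    compatibility with the two-sided action follows by using it twice.  On the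
    image of the dual numbers, [Etilde] is the identity because phi 1 = 1. *)

Lemma Etilde_linear (R : realType) (S : ncpsB R) : linear (Etilde S).
Proof.
move=> k [a [xi b]] [a' [xi' b']]; apply/pair_equal_spec; split=> /=.
  by rewrite linearP.
by rewrite !linearP /= addrACA -mulrDr.
Qed.

(** In the second component, the two sides are
    x f(xi) + (t phi(a) + x phi(b)) and x (f(xi) + phi(b)) + t phi(a). *)
Lemma Etilde_CC_mul (R : realType) (S : ncpsB R) (c : CC R) (w : AE S) :
  Etilde S (CC_mul c w) = c * Etilde S w.
Proof.
case: c w => [x t] [a [xi b]]; apply/pair_equal_spec; split=> /=.
  by rewrite linearZ.
by rewrite add0r linearD !linearZ /= mulrDr -addrA [X in _ + X]addrC.
Qed.

Lemma Etilde_CC_to_AE (R : realType) (S : ncpsB R) (c : CC R) :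
  Etilde S (CC_to_AE S c) = c.
Proof.
case: c => [x t]; rewrite /Etilde /CC_to_AE /=.
by rewrite !linearZ /= phi1 linear0 add0r !mulr1.
Qed.

Theorem mainTheorem1 (R : realType) (S : ncpsB R) :
  [/\ forall (a : algA S) (xi : modX S),
        Etilde S (AX_to_AE S (a, xi)) = E S (a, xi),
      conditional_expectation (CC_to_AE S) (CC_bimodule S) (Etilde S)
    & forall (x t : R[i]) (a : algA S) (xi : modX S) (b : algA S),
        Etilde S (lact (CC_bimodule S) (x, t) (a, (xi, b)))
        = ((x, t) : CC R) * Etilde S (a, (xi, b))].
Proof.
split.
- by move=> a xi; rewrite /Etilde /AX_to_AE /E /= linear0 addr0.
- split; [exact: Etilde_linear | | exact: Etilde_CC_to_AE].
  move=> c w d; rewrite /= /CC_act !Etilde_CC_mul.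
  by rewrite -mulrA [d * _]mulrC.
- move=> x t a xi b; rewrite CC_lactE.
  exact: (Etilde_CC_mul _ _ (x, t) (a, (xi, b))).
Qed.
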